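(* Every polynomial identity of degree $\le 4$ relating the bilinear operation $[x,y]=\alpha(x\wedge y)$ and the trilinear operation $(x,y,z)=\beta(x\wedge y)\cdot z$ on the $\mathfrak{sl}(2,\mathbb{C})$-module $V(6)$ is a consequence of the anticommutativity $[a,b]+[b,a]\equiv0$, the skew-symmetry $(a,b,c)+(b,a,c)\equiv0$, the mixed Jacobi identity $$[[a,b],c]+[[b,c],a]+[[c,a],b]+(a,b,c)+(b,c,a)+(c,a,b)\equiv0,$$ the Malcev identity $$[[[a,c],b],d]+[[[d,a],c],b]+[[[c,b],d],a]+[[[b,d],a],c]-[[a,b],[c,d]]\equiv0,$$ and the two identities $$([a,b],c,d)+([b,c],a,d)+([c,a],b,d)\equiv0,$$ $$[(a,b,c),d]-[(a,b,d),c]-(a,b,[c,d])\equiv0.$$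
   Context: $V(6)$ is the 7-dimensional irreducible $\mathfrak{sl}(2,\mathbb{C})$-module with basis $v_6,v_4,v_2,v_0,v_{-2},v_{-4},v_{-6}$ of $H$-eigenvectors, where $H\cdot v_{6-2i}=(6-2i)v_{6-2i}$, $E\cdot v_{6-2i}=(7-i)v_{6-2(i-1)}$, $F\cdot v_{6-2i}=(i+1)v_{6-2(i+1)}$ (with $v_8=v_{-8}=0$). Here $H,E,F$ is the standard basis of $\mathfrak{sl}(2,\mathbb{C})$, with $[H,E]=2E$, $[H,F]=-2F$, $[E,F]=H$. The map $\alpha\colon\Lambda^2V(6)\to V(6)$ is the (unique up to nonzero scalar) nonzero $\mathfrak{sl}(2,\mathbb{C})$-module morphism, normalized so that $[x,y]=\alpha(x\wedge y)$ is the anticommutative product with $[v_6,v_0]=20v_6$, $[v_6,v_{-2}]=10v_4$, $[v_6,v_{-4}]=4v_2$, $[v_6,v_{-6}]=v_0$, $[v_4,v_2]=-60v_6$, $[v_4,v_0]=-20v_4$, $[v_4,v_{-4}]=6v_0$, $[v_4,v_{-6}]=4v_{-2}$, $[v_2,v_0]=-20v_2$, $[v_2,v_{-2}]=-15v_0$, $[v_2,v_{-6}]=10v_{-4}$, $[v_0,v_{-2}]=-20v_{-2}$, $[v_0,v_{-4}]=-20v_{-4}$, $[v_0,v_{-6}]=20v_{-6}$, $[v_{-2},v_{-4}]=-60v_{-6}$, and all other products $[v_p,v_q]$ with $p>q$ equal to $0$. The map $\beta\colon\Lambda^2V(6)\to V(2)\approx\mathfrak{sl}(2,\mathbb{C})$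 is an $\mathfrak{sl}(2,\mathbb{C})$-module morphism, unique up to nonzero scalar; its scalar is chosen compatibly with $\alpha$ as $\beta=-30\,\beta_0$, where, with $u_2=-E$, $u_0=H$, $u_{-2}=F$, $\beta_0(v_6\wedge v_{-4})=2u_2$, $\beta_0(v_6\wedge v_{-6})=u_0$, $\beta_0(v_4\wedge v_{-2})=-10u_2$, $\beta_0(v_4\wedge v_{-4})=-4u_0$, $\beta_0(v_4\wedge v_{-6})=2u_{-2}$, $\beta_0(v_2\wedge v_0)=20u_2$, $\beta_0(v_2\wedge v_{-2})=5u_0$, $\beta_0(v_2\wedge v_{-4})=-10u_{-2}$, $\beta_0(v_0\wedge v_{-2})=20u_{-2}$, and $\beta_0(v_p\wedge v_q)=0$ for all other $p>q$. The dot in $\beta(x\wedge y)\cdot z$ is the action of $\mathfrak{sl}(2,\mathbb{C})$ on $V(6)$. A polynomial identity of degree $\le n$ relating the two operations is a nonassociative polynomial over $\mathbb{C}$ of degree $\le n$, each of whose monomials may involve the bilinear operation, the trilinear operation, or both, which vanishes for all substitutions of elements of $V(6)$ for the variables. An identity is a consequence of a set of identities if it is satisfied by every vector space over $\mathbb{C}$ with a bilinear and a trilinear operation satisfying all identities in the set. *)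

(* Defs.v *)
From HB Require Import structures.
From mathcomp Require Import all_boot all_order all_algebra.
From mathcomp Require Import sesquilinear.
From mathcomp Require Import finmap monalg ring.

Set Implicit Arguments.
Unset Strict Implicit.
Unset Printing Implicit Defensive.

Import GRing.Theory.
Local Open Scope ring_scope.

(* Nonassociative monomials in the variables x_0, x_1, ...: [Br m n] is the
   bilinear operation [m, n], [Tr m n p] is the trilinear operation (m, n, p). *)
Inductive nmonom : Type :=
  | Var of nat
  | Br of nmonom & nmonom
  | Tr of nmonom & nmonom & nmonom.

Fixpoint nmonom_encode (m : nmonom) : GenTree.tree nat :=
  match m with
  | Var k => GenTree.Leaf k
  | Br m n => GenTree.Node 0 [:: nmonom_encode m; nmonom_encode n]
  | Tr m n p =>
      GenTree.Node 0 [:: nmonom_encode m; nmonom_encode n; nmonom_encode p]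
  end.

Fixpoint nmonom_decode (t : GenTree.tree nat) : option nmonom :=
  match t with
  | GenTree.Leaf k => Some (Var k)
  | GenTree.Node _ [:: t1; t2] =>
      if (nmonom_decode t1, nmonom_decode t2) is (Some m, Some n)
      then Some (Br m n) else None
  | GenTree.Node _ [:: t1; t2; t3] =>
      if (nmonom_decode t1, nmonom_decode t2, nmonom_decode t3)
        is (Some m, Some n, Some p)
      then Some (Tr m n p) else None
  | _ => None
  end.

Lemma nmonom_encodeK : pcancel nmonom_encode nmonom_decode.
Proof. by elim=> [k|m IHm n IHn|m IHm n IHn p IHp] //=; rewrite IHm IHn ?IHp. Qed.

HB.instance Definition _ := Countable.copy nmonom (pcan_type nmonom_encodeK).

Fixpoint ndegree (m : nmonom) : nat :=
  match m with
  | Var _ => 1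
  | Br m n => ndegree m + ndegree n
  | Tr m n p => ndegree m + ndegree n + ndegree p
  end.

(* The free K-module on the monomials; there is no empty monomial, hence no
   constant term. *)
Notation nonassoc_poly K := {malg K[nmonom]}.

Definition degree_le (K : fieldType) (n : nat) (f : nonassoc_poly K) : Prop :=
  forall m : nmonom, m \in msupp f -> (ndegree m <= n)%N.

Record bitri_algebra (K : fieldType) : Type := BitriAlgebra {
  carrier :> lmodType K;
  brk : carrier -> carrier -> carrier;
  trp : carrier -> carrier -> carrier -> carrier;
  brk_bilinear : bilinear_for *:%R *:%R brk;
  trp_bilinear12 : forall z, bilinear_for *:%R *:%R (fun x y => trp x y z);
  trp_linear3 : forall x y, linear (trp x y)
}.

Fixpoint nmeval (K : fieldType) (A : bitri_algebra K) (s : nat -> A)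
    (m : nmonom) : A :=
  match m with
  | Var k => s k
  | Br m n => brk (nmeval s m) (nmeval s n)
  | Tr m n p => trp (nmeval s m) (nmeval s n) (nmeval s p)
  end.

Definition neval (K : fieldType) (A : bitri_algebra K) (s : nat -> A)
    (f : nonassoc_poly K) : A :=
  \sum_(m <- msupp f) f@_m *: nmeval s m.

Definition satisfies (K : fieldType) (A : bitri_algebra K) (f : nonassoc_poly K) : Prop :=
  forall s : nat -> A, neval s f = 0.

Definition consequence (K : fieldType) (S : seq (nonassoc_poly K)) (f : nonassoc_poly K) : Prop :=
  forall A : bitri_algebra K, {in S, forall g, satisfies A g} -> satisfies A f.

Section Identities.
Variable K : fieldType.

Local Notation a := (Var 0).
Local Notation b := (Var 1).
Local Notation c := (Var 2).
Local Notation d := (Var 3).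

Definition anticommutativity : nonassoc_poly K := <<Br a b>> + <<Br b a>>.

Definition skew_symmetry : nonassoc_poly K := <<Tr a b c>> + <<Tr b a c>>.

Definition mixed_jacobi : nonassoc_poly K :=
  <<Br (Br a b) c>> + <<Br (Br b c) a>> + <<Br (Br c a) b>>
  + <<Tr a b c>> + <<Tr b c a>> + <<Tr c a b>>.

Definition malcev : nonassoc_poly K :=
  <<Br (Br (Br a c) b) d>> + <<Br (Br (Br d a) c) b>>
  + <<Br (Br (Br c b) d) a>> + <<Br (Br (Br b d) a) c>>
  - <<Br (Br a b) (Br c d)>>.

Definition cyclic_identity : nonassoc_poly K :=
  <<Tr (Br a b) c d>> + <<Tr (Br b c) a d>> + <<Tr (Br c a) b d>>.

Definition derivation_identity : nonassoc_poly K :=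
  <<Br (Tr a b c) d>> - <<Br (Tr a b d) c>> - <<Tr a b (Br c d)>>.

End Identities.

(* V(6) is 'rV_7, the coordinate of index i being the one along v_{6-2i}. *)
Section V6.
Variable K : fieldType.

Local Notation V := 'rV[K]_7.

Definition wt (i : 'I_7) : int := 6 - 2 * (i : nat)%:Z.

(* v p is zero when p is not a weight of V(6), e.g. v 8 = v (-8) = 0. *)
Definition wvec (p : int) : V := \row_i (p == wt i)%:R.
Local Notation v := wvec.

Definition crd (x : V) (p : int) : K := \sum_(i | p == wt i) x 0 i.

Definition actH (x : V) : V := \sum_i x 0 i *: ((wt i)%:~R *: v (wt i)).
Definition actE (x : V) : V := \sum_i x 0 i *: ((7 - i)%N%:R *: v (wt i + 2)).
Definition actF (x : V) : V := \sum_i x 0 i *: (i.+1%:R *: v (wt i - 2)).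

(* The coordinate of x /\ y along v_p /\ v_q, in the basis of the exterior
   square of V(6) formed by the v_p /\ v_q with p > q. *)
Definition wedge_crd (x y : V) (pq : int * int) : K :=
  crd x pq.1 * crd y pq.2 - crd x pq.2 * crd y pq.1.

(* The value at x /\ y of the linear map on the exterior square that sends
   v_p /\ v_q to w for each ((p, q), w) in the table t, and the other basis
   vectors v_p /\ v_q, p > q, to 0. *)
Definition wedge_map (W : lmodType K) (t : seq ((int * int) * W)) (x y : V) : W :=
  \sum_(e <- t) wedge_crd x y e.1 *: e.2.

Definition alpha_table : seq ((int * int) * V) :=
  [:: ((6, 0), 20 *: v 6);
      ((6, -2), 10 *: v 4);
      ((6, -4), 4 *: v 2);
      ((6, -6), v 0);
      ((4, 2), - 60 *: v 6);
      ((4, 0), - 20 *: v 4);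
      ((4, -4), 6 *: v 0);
      ((4, -6), 4 *: v (-2));
      ((2, 0), - 20 *: v 2);
      ((2, -2), - 15 *: v 0);
      ((2, -6), 10 *: v (-4));
      ((0, -2), - 20 *: v (-2));
      ((0, -4), - 20 *: v (-4));
      ((0, -6), 20 *: v (-6));
      ((-2, -4), - 60 *: v (-6))].

Definition alpha (x y : V) : V := wedge_map alpha_table x y.

(* sl(2) inside the 2 x 2 matrices. *)
Definition slE : 'M[K]_2 := delta_mx 0 1.
Definition slF : 'M[K]_2 := delta_mx 1 0.
Definition slH : 'M[K]_2 := delta_mx 0 0 - delta_mx 1 1.

(* The action on V(6) of a traceless A = A_01 E + A_00 H + A_10 F. *)
Definition sl2_act (A : 'M[K]_2) (x : V) : V :=
  A 0 1 *: actE x + A 0 0 *: actH x + A 1 0 *: actF x.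

Definition u2 : 'M[K]_2 := - slE.
Definition u0 : 'M[K]_2 := slH.
Definition um2 : 'M[K]_2 := slF.

Definition beta0_table : seq ((int * int) * 'M[K]_2) :=
  [:: ((6, -4), 2 *: u2);
      ((6, -6), u0);
      ((4, -2), - 10 *: u2);
      ((4, -4), - 4 *: u0);
      ((4, -6), 2 *: um2);
      ((2, 0), 20 *: u2);
      ((2, -2), 5 *: u0);
      ((2, -4), - 10 *: um2);
      ((0, -2), 20 *: um2)].

Definition beta0 (x y : V) : 'M[K]_2 := wedge_map beta0_table x y.
Definition beta (x y : V) : 'M[K]_2 := - 30 *: beta0 x y.

Definition V6_brk (x y : V) : V := alpha x y.
Definition V6_trp (x y z : V) : V := sl2_act (beta x y) z.

Lemma crd_linear p : linear_for *%R (crd^~ p).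
Proof.
move=> k x y; rewrite /crd mulr_sumr -big_split /=.
by apply: eq_bigr => i _; rewrite !mxE.
Qed.

Lemma wedge_map_bilinear (W : lmodType K) (t : seq ((int * int) * W)) :
  bilinear_for *:%R *:%R (wedge_map t).
Proof.
split=> [y|x] k z1 z2 /=; rewrite /wedge_map scaler_sumr -big_split /=;
  apply: eq_bigr => e _; rewrite /wedge_crd !crd_linear scalerA -scalerDl;
  by congr (_ *: _); rewrite /=; ring.
Qed.

Lemma sum_basis_linear (w : 'I_7 -> V) : linear (fun x : V => \sum_i x 0 i *: w i).
Proof.
move=> k x y; rewrite scaler_sumr -big_split /=.
by apply: eq_bigr => i _; rewrite !mxE scalerDl scalerA.
Qed.

Lemma sl2_act_linear (A : 'M[K]_2) : linear (sl2_act A).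
Proof.
move=> k x y; rewrite /sl2_act /actE /actH /actF !sum_basis_linear.
rewrite !scalerDr !scalerA ![_ * k]mulrC.
by rewrite [RHS]addrACA; congr (_ + _); rewrite addrACA.
Qed.

Lemma sl2_act_linearl (x : V) : linear (sl2_act^~ x).
Proof.
move=> k A B; rewrite /sl2_act !mxE !scalerDl !scalerDr !scalerA.
by rewrite [RHS]addrACA; congr (_ + _); rewrite addrACA.
Qed.

Lemma V6_trp_bilinear12 z : bilinear_for *:%R *:%R (fun x y => V6_trp x y z).
Proof.
split=> [y|x] k z1 z2 /=; rewrite /V6_trp /beta /beta0.
- by rewrite (wedge_map_bilinear _).1 scalerDr scalerA (mulrC _ k) -scalerA sl2_act_linearl.
- by rewrite (wedge_map_bilinear _).2 scalerDr scalerA (mulrC _ k) -scalerA sl2_act_linearl.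
Qed.

Definition V6 : bitri_algebra K :=
  BitriAlgebra (wedge_map_bilinear alpha_table : bilinear_for *:%R *:%R V6_brk)
    V6_trp_bilinear12 (fun x y => @sl2_act_linear (beta x y)).

End V6.

(* Main.v *)
Require Import Defs.
From Stdlib Require Import ZArith.
From mathcomp Require Import all_boot all_order all_algebra reals.
From mathcomp Require Import complex monalg.
From mathcomp Require Import finmap ssrZ zify ring.

(** Over a field of characteristic zero it is enough to treat multilinear
    identities. If [f] is an identity of V(6), so are its homogeneous components
    ([homogeneous_component]), and so are the full polarizations of each
    component ([polarization]). A component is recovered from its polarizations,
    up to the factor [n!], by setting variables equal ([restitution]). Hence the
    theorem follows once every multilinear identity of V(6) of degree
    [n <= 4] holds in every algebra [A] that satisfies the six identities
    ([multilinear_reduction]).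

    That is a finite problem of linear algebra. Anticommutativity and
    skew-symmetry express each multilinear monomial as plus or minus a canonical
    one ([nmeval_canon], [collect_canonical]). On the space spanned by the
    canonical monomials there are two families of integer vectors: the
    consequences of the other four identities, which vanish in [A]
    ([zeval_relations]), and the functionals that take a polynomial to a
    coordinate of its value at weight vectors of V(6), which vanish on
    identities of V(6) ([zdot_highest_weight_row]). The ranks of the two families
    add up to the number of canonical monomials, 24 + 21 = 45 in degree four, so
    every identity of V(6) is a combination of the consequences. Exact integer
    elimination verifies this complementarity ([identities_suffice_le4]), and
    [complementary_pairing_eq0] draws the conclusion. The coordinates at weight
    vectors are integers because the product of weight vectors is an integer
    multiple of a weight vector ([nmeval_zvec]). *)

Set Implicit Arguments.
Unset Strict Implicit.
Unset Printing Implicit Defensive.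

Import Order.TTheory GRing.Theory Num.Theory.
Local Open Scope ring_scope.
Delimit Scope Z_scope with coqZ.

(** * Fraction-free elimination on integer vectors *)

Fixpoint lincomb (a : Z) (u : seq Z) (b : Z) (v : seq Z) : seq Z :=
  match u, v with
  | x :: u', y :: v' => Z.add (Z.mul a x) (Z.mul b y) :: lincomb a u' b v'
  | _, [::] => map (Z.mul a) u
  | [::], _ => map (Z.mul b) v
  end.

Definition is_zero (v : seq Z) : bool := all (Z.eqb Z0) v.

(** Division by the content; the test makes soundness independent of
    divisibility facts about [Z.gcd]. *)
Definition primitive (v : seq Z) : seq Z :=
  let g := foldr Z.gcd Z0 v in
  let v' := map (fun x => Z.div x g) v in
  if ~~ Z.eqb g Z0 && (map (Z.mul g) v' == v) then v' else v.

(** The divisor [g] carries the sign of the pivot, so that [v] is multiplied by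
    a positive number, and by [1] when the pivot is [1] or [-1]. *)
Definition eliminate (v : seq Z) (pr : nat * seq Z) : seq Z :=
  let x := nth Z0 v pr.1 in
  let d := nth Z0 pr.2 pr.1 in
  if Z.eqb x Z0 then v else
  let g := Z.mul (Z.sgn d) (Z.gcd d x) in
  let a := Z.div d g in
  if Z.eqb a Z0 then v else lincomb a v (Z.opp (Z.div x g)) pr.2.

Definition reduce (rows : seq (nat * seq Z)) (v : seq Z) : seq Z :=
  foldl eliminate v rows.

(** Unit pivots are preferred: reduction by them does not rescale vectors. *)
Definition pivot (v : seq Z) : nat :=
  let i := find (fun x => Z.eqb (Z.abs x) 1%coqZ) v in
  if (i < size v)%N then i else find (fun x => ~~ Z.eqb x Z0) v.

Definition echelon (vs : seq (seq Z)) : seq (nat * seq Z) :=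
  foldl (fun rows v =>
    let w := reduce rows v in
    if is_zero w then rows
    else let w' := primitive w in rcons rows (pivot w', w')) [::] vs.

Definition unit_vector (N i : nat) : seq Z :=
  mkseq (fun j => if j == i then 1%coqZ else Z0) N.

(** A test that the span of [R] contains the common kernel of the functionals
    [V]. The row [i] of [M] is congruent to the unit vector [i] modulo [R] as
    soon as reduction does not rescale, so as soon as [R] has unit pivots. *)
Definition complementary (N : nat) (R V : seq (seq Z)) : bool :=
  let E := echelon R in
  let F := echelon V in
  let M := mkseq (fun i => reduce E (unit_vector N i)) N in
  all (fun i => is_zero (reduce E
    (lincomb 1%coqZ (unit_vector N i) ((-1)%coqZ) (nth [::] M i)))) (iota 0 N)
  && all (fun j => is_zero (reduce F (map (fun r => nth Z0 r j) M))) (iota 0 N).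

Definition ofZ (K : numFieldType) (z : Z) : K := (int_of_Z z)%:~R.

Section OfZ.
Variable K : numFieldType.

Lemma ofZ1 : ofZ K 1%coqZ = 1. Proof. by []. Qed.

Lemma ofZD x y : ofZ K (Z.add x y) = ofZ K x + ofZ K y.
Proof. by rewrite /ofZ -rmorphD /= -raddfD. Qed.

Lemma ofZM x y : ofZ K (Z.mul x y) = ofZ K x * ofZ K y.
Proof. by rewrite /ofZ -rmorphM /= -rmorphM. Qed.

Lemma ofZN x : ofZ K (Z.opp x) = - ofZ K x.
Proof. by rewrite /ofZ -rmorphN /= -raddfN. Qed.

Lemma ofZ_eq0 x : (ofZ K x == 0) = Z.eqb x Z0.
Proof. by rewrite /ofZ intr_eq0; case: x => [|p|p] //=; lia. Qed.

End OfZ.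

Section Pairing.
Variables (K : numFieldType) (G : lmodType K).
Implicit Types (g : seq G) (u v : seq Z).

Definition zdot v g : G := \sum_(i < size g) ofZ K (nth Z0 v i) *: g`_i.

Lemma nth_lincomb a u b v i :
  nth Z0 (lincomb a u b v) i
  = Z.add (Z.mul a (nth Z0 u i)) (Z.mul b (nth Z0 v i)).
Proof.
have nthm c w k : nth Z0 (map (Z.mul c) w) k = Z.mul c (nth Z0 w k).
  by elim: w k => [|x w IHw] [|k] //=; rewrite ?IHw ?Z.mul_0_r.
elim: u v i => [|x u IHu] [|y v] i.
- by rewrite nth_nil !Z.mul_0_r.
- by rewrite nthm nth_nil Z.mul_0_r.
- by rewrite nthm nth_nil Z.mul_0_r Z.add_0_r.
- by case: i => [|i] //=; rewrite IHu.
Qed.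

Lemma zdot_lincomb a u b v g :
  zdot (lincomb a u b v) g = ofZ K a *: zdot u g + ofZ K b *: zdot v g.
Proof.
rewrite /zdot !scaler_sumr -big_split /=; apply: eq_bigr => i _.
by rewrite nth_lincomb ofZD !ofZM scalerDl !scalerA.
Qed.

Lemma zdot_is_zero v g : is_zero v -> zdot v g = 0.
Proof.
move=> /allP v0; rewrite /zdot big1 // => i _.
have [ltiv|] := ltnP i (size v); last by move=> ?; rewrite nth_default ?scale0r.
by have /v0/Z.eqb_eq <- := mem_nth Z0 ltiv; rewrite scale0r.
Qed.

Lemma zdot_primitive v g : zdot v g = 0 -> zdot (primitive v) g = 0.
Proof.
rewrite /primitive; set d := foldr _ _ _; set v' := map (fun x => Z.div x d) _.
case: ifP => // /andP[nd /eqP dv'].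
have : zdot (map (Z.mul d) v') g = ofZ K d *: zdot v' g.
  rewrite /zdot scaler_sumr; apply: eq_bigr => i _; rewrite scalerA -ofZM.
  congr (ofZ _ _ *: _); elim: (v') (i : nat) => [|x w IHw] [|k] //=;
    by rewrite ?IHw ?Z.mul_0_r.
by rewrite dv' => -> /eqP; rewrite scaler_eq0 ofZ_eq0 (negPf nd) => /eqP.
Qed.

Lemma zdot_eliminate v pr g : zdot pr.2 g = 0 ->
  exists2 c, c != 0 & zdot (eliminate v pr) g = c *: zdot v g.
Proof.
move=> pr0; have id1 : exists2 c, c != 0 & zdot v g = c *: zdot v g.
  by exists (1 : K); rewrite ?oner_eq0 ?scale1r.
rewrite /eliminate; case: ifP => // _; set a := Z.div _ _.
case: ifP => // a0; exists (ofZ K a); first by rewrite ofZ_eq0 a0.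
by rewrite zdot_lincomb pr0 scaler0 addr0.
Qed.

Lemma zdot_reduce rows v g : (forall pr, pr \in rows -> zdot pr.2 g = 0) ->
  exists2 c, c != 0 & zdot (reduce rows v) g = c *: zdot v g.
Proof.
elim: rows v => [|pr rows IHr] v rows0 /=.
  by exists (1 : K); rewrite ?oner_eq0 ?scale1r.
have [c nc ec] := zdot_eliminate v (rows0 _ (mem_head _ _)).
have [|d nd ed] := IHr (eliminate v pr).
  by move=> q qr; apply: rows0; rewrite inE qr orbT.
by exists (d * c); rewrite ?mulf_neq0 // ed ec scalerA.
Qed.

(** Pairing to zero against [g] is preserved by every step of the elimination,
    so a vector that reduces to zero pairs to zero. *)
Lemma zdot_reduce_eq0 rows v g : (forall pr, pr \in rows -> zdot pr.2 g = 0) ->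
  is_zero (reduce rows v) -> zdot v g = 0.
Proof.
move=> rows0 v0; have [c nc] := zdot_reduce v rows0.
by rewrite zdot_is_zero // => /esym/eqP; rewrite scaler_eq0 (negPf nc) => /eqP.
Qed.

Lemma zdot_echelon vs g : (forall v, v \in vs -> zdot v g = 0) ->
  forall pr, pr \in echelon vs -> zdot pr.2 g = 0.
Proof.
rewrite /echelon; set step := (fun _ _ => _).
have: forall pr : nat * seq Z, pr \in [::] -> zdot pr.2 g = 0 by [].
elim: vs [::] => [|v vs IHvs] rows //= rows0 vs0; apply: IHvs; last first.
  by move=> w wvs; apply: vs0; rewrite inE wvs orbT.
rewrite /step; case: ifP => // _ pr; rewrite mem_rcons inE.
case/predU1P => [->|]; last exact: rows0.
apply: zdot_primitive; have [c _ ->] := zdot_reduce v rows0.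
by rewrite vs0 ?mem_head // scaler0.
Qed.

Lemma zdot_unit_vector g i : (i < size g)%N ->
  zdot (unit_vector (size g) i) g = g`_i.
Proof.
move=> lti; rewrite /zdot (bigD1 (Ordinal lti)) //= nth_mkseq // eqxx ofZ1.
rewrite scale1r big1 ?addr0 // => j; rewrite -val_eqE /= => ne.
by rewrite nth_mkseq // (negPf ne) scale0r.
Qed.

End Pairing.

(** If the annihilator of the functionals [V] lies in the span of the vectors
    [R], then a coefficient vector [c] killed by [V] is a combination of [R],
    so it pairs to zero with any [g] killed by [R].  The test produces a
    normal form matrix [M] of the quotient by [R] and checks two things:
    every unit vector is congruent to its row of [M], and every column of [M]
    is a combination of [V]. *)
Lemma complementary_pairing_eq0 (K : numFieldType) (G : lmodType K)
    (R V : seq (seq Z)) (c : seq K) (g : seq G) :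
    complementary (size g) R V -> size c = size g ->
    (forall r, r \in R -> zdot r g = 0) ->
    (forall v, v \in V -> zdot v (c : seq K^o) = 0) ->
  \sum_(i < size g) c`_i *: g`_i = 0.
Proof.
rewrite /complementary; set M := mkseq _ _.
move=> /andP[/allP rowsM /allP colsM] szc R0 V0.
have gM i : (i < size g)%N -> g`_i = zdot (nth [::] M i) g.
  move=> lti; have := rowsM i; rewrite mem_iota lti => /(_ isT).
  move/(zdot_reduce_eq0 (zdot_echelon R0))/eqP.
  by rewrite zdot_lincomb zdot_unit_vector // scale1r scaleN1r subr_eq0 => /eqP.
transitivity (\sum_(i < size g) c`_i *: zdot (nth [::] M i) g).
  by apply: eq_bigr => i _; rewrite {1}gM.
under eq_bigr do rewrite /zdot scaler_sumr.
rewrite exchange_big big1 //= => j _.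
under eq_bigr do rewrite scalerA.
rewrite -scaler_suml.
have := colsM j; rewrite mem_iota ltn_ord => /(_ isT).
move/(zdot_reduce_eq0 (zdot_echelon V0)); rewrite /zdot szc => cj.
suff -> : \sum_(i < size g) c`_i * ofZ K (nth Z0 (nth [::] M i) j) = 0.
  by rewrite scale0r.
rewrite -[RHS]cj; apply: eq_bigr => i _.
by rewrite (nth_map [::]) ?size_mkseq // mulrC.
Qed.

(** * Words and multilinear expansion *)

Fixpoint words (X : Type) (r : seq X) (d : nat) : seq (seq X) :=
  if d is d'.+1 then [seq k :: w | k <- r, w <- words r d'] else [:: [::]].

Lemma mem_words (X : eqType) (r : seq X) d w :
  (w \in words r d) = (size w == d) && all (mem r) w.
Proof.
elim: d w => [|d IHd] w /=; first by rewrite inE; case: w.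
apply/allpairsP/andP => [[[k u] /= [kr ud ->]]|[]].
  by move: ud; rewrite IHd /= kr eqSS => /andP[-> ->].
case: w => [|k u] //= szu /andP[kr ur]; exists (k, u); split=> //.
by rewrite IHd -eqSS szu.
Qed.

Lemma words_uniq (X : eqType) (r : seq X) d : uniq r -> uniq (words r d).
Proof.
move=> ur; elim: d => //= d IHd.
by rewrite allpairs_uniq // => -[k u] [l v] _ _ [-> ->].
Qed.

Lemma big_words_cat (G : nmodType) (X : Type) (r : seq X) d1 d2
    (F : seq X -> G) :
  \sum_(w <- words r (d1 + d2)) F w
  = \sum_(u <- words r d1) \sum_(v <- words r d2) F (u ++ v).
Proof.
elim: d1 F => [|d1 IHd] F /=; first by rewrite big_seq1.
rewrite !big_allpairs_dep /=; apply: eq_bigr => k _.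
by rewrite (IHd (fun w => F (k :: w))).
Qed.

Lemma big_words_prod (K : comNzRingType) (X : Type) (x0 : X) (r : seq X) n
    (g : nat -> X -> K) :
  \sum_(b <- words r n) \prod_(k < n) g k (nth x0 b k)
  = \prod_(k < n) \sum_(x <- r) g k x.
Proof.
elim: n g => [|n IHn] g /=; first by rewrite big_seq1 !big_ord0.
rewrite big_allpairs_dep big_ord_recl mulr_suml /=; apply: eq_bigr => x _.
rewrite -(IHn (fun k => g k.+1)) mulr_sumr; apply: eq_bigr => b _.
by rewrite big_ord_recl.
Qed.

Lemma linear_fun0 (K : fieldType) (U V : lmodType K) (h : U -> V) :
  linear h -> h 0 = 0.
Proof.
by move=> lh; have := lh (-1) 0 0; rewrite scaler0 addr0 scaleN1r addNr.
Qed.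

Lemma linear_fun_sum (K : fieldType) (U V : lmodType K) (h : U -> V)
    (I : Type) (r : seq I) (c : I -> K) (u : I -> U) :
  linear h -> h (\sum_(i <- r) c i *: u i) = \sum_(i <- r) c i *: h (u i).
Proof.
move=> lh; elim: r => [|i r IHr]; last by rewrite !big_cons lh IHr.
by rewrite !big_nil linear_fun0.
Qed.

Lemma brk_sum (K : fieldType) (A : bitri_algebra K) (I J : Type)
    (r : seq I) (q : seq J) (c : I -> K) (e : J -> K) (u : I -> A) (v : J -> A) :
  brk (\sum_(i <- r) c i *: u i) (\sum_(j <- q) e j *: v j)
  = \sum_(i <- r) \sum_(j <- q) (c i * e j) *: brk (u i) (v j).
Proof.
have [brl brr] := brk_bilinear A.
rewrite (linear_fun_sum _ _ _ (brl _)); apply: eq_bigr => i _.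
rewrite (linear_fun_sum _ _ _ (brr _)) scaler_sumr; apply: eq_bigr => j _.
by rewrite scalerA.
Qed.

Lemma trp_sum (K : fieldType) (A : bitri_algebra K) (I J L : Type)
    (r : seq I) (q : seq J) (p : seq L) (c : I -> K) (e : J -> K) (d : L -> K)
    (u : I -> A) (v : J -> A) (w : L -> A) :
  trp (\sum_(i <- r) c i *: u i) (\sum_(j <- q) e j *: v j)
      (\sum_(l <- p) d l *: w l)
  = \sum_(i <- r) \sum_(j <- q) \sum_(l <- p)
      (c i * e j * d l) *: trp (u i) (v j) (w l).
Proof.
set z := \sum_(l <- p) _; have [trl trr] := trp_bilinear12 z.
rewrite (linear_fun_sum _ _ _ (trl _)); apply: eq_bigr => i _.
rewrite (linear_fun_sum _ _ _ (trr _)) scaler_sumr; apply: eq_bigr => j _.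
rewrite (linear_fun_sum _ _ _ (trp_linear3 _ _)) !scaler_sumr.
by apply: eq_bigr => l _; rewrite !scalerA.
Qed.

(** * Monomials as a shape filled with a word *)

Fixpoint leaves (m : nmonom) : seq nat :=
  match m with
  | Var k => [:: k]
  | Br a b => leaves a ++ leaves b
  | Tr a b c => leaves a ++ leaves b ++ leaves c
  end.

Fixpoint shape (m : nmonom) : nmonom :=
  match m with
  | Var _ => Var 0
  | Br a b => Br (shape a) (shape b)
  | Tr a b c => Tr (shape a) (shape b) (shape c)
  end.

(** The monomial of shape [t] with leaves [w], read from left to right. *)
Fixpoint fill (t : nmonom) (w : seq nat) : nmonom :=
  match t with
  | Var _ => Var (head 0%N w)
  | Br a b => Br (fill a (take (ndegree a) w)) (fill b (drop (ndegree a) w))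
  | Tr a b c =>
      let w' := drop (ndegree a) w in
      Tr (fill a (take (ndegree a) w)) (fill b (take (ndegree b) w'))
         (fill c (drop (ndegree b) w'))
  end.

(** The multilinear operation of shape [t]; the labels of [t] are ignored. *)
Fixpoint plug (K : fieldType) (A : bitri_algebra K) (t : nmonom) (xs : seq A) : A :=
  match t with
  | Var _ => head 0 xs
  | Br a b => brk (plug a (take (ndegree a) xs)) (plug b (drop (ndegree a) xs))
  | Tr a b c =>
      let xs' := drop (ndegree a) xs in
      trp (plug a (take (ndegree a) xs)) (plug b (take (ndegree b) xs'))
          (plug c (drop (ndegree b) xs'))
  end.

Lemma size_leaves m : size (leaves m) = ndegree m.
Proof. by elim: m => //= *; rewrite !size_cat; lia. Qed.

Lemma ndegree_gt0 m : (0 < ndegree m)%N.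
Proof. by elim: m => //= *; lia. Qed.

Lemma ndegree_shape m : ndegree (shape m) = ndegree m.
Proof. by elim: m => //= [a -> b ->|a -> b -> c ->]. Qed.

Lemma ndegree_fill t w : ndegree (fill t w) = ndegree t.
Proof.
by elim: t w => //= [a IHa b IHb|a IHa b IHb c IHc] w; rewrite IHa IHb ?IHc.
Qed.

Lemma shape_fill t w : shape (fill t w) = shape t.
Proof.
by elim: t w => //= [a IHa b IHb|a IHa b IHb c IHc] w; rewrite IHa IHb ?IHc.
Qed.

Lemma fill_shape_leaves m : fill (shape m) (leaves m) = m.
Proof.
elim: m => //= [a IHa b IHb|a IHa b IHb c IHc]; rewrite !ndegree_shape.
  by rewrite -size_leaves take_size_cat // drop_size_cat // IHa IHb.
rewrite -!size_leaves take_size_cat // drop_size_cat //.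
by rewrite take_size_cat // drop_size_cat // IHa IHb IHc.
Qed.

Lemma leaves_fill t w : size w = ndegree t -> leaves (fill t w) = w.
Proof.
elim: t w => /= [k|a IHa b IHb|a IHa b IHb c IHc] w szw.
- by case: w szw => [|x [|]].
- by rewrite IHa ?IHb ?cat_take_drop // ?size_takel ?size_drop; lia.
rewrite IHa ?IHb ?IHc ?cat_take_drop // ?size_takel ?size_drop //; lia.
Qed.

Lemma nmeval_fill (K : fieldType) (A : bitri_algebra K) (s : nat -> A) t w :
  size w = ndegree t -> nmeval s (fill t w) = plug t (map s w).
Proof.
elim: t w => /= [k|a IHa b IHb|a IHa b IHb c IHc] w szw.
- by case: w szw => [|x [|]].
- by rewrite IHa ?IHb ?map_take ?map_drop // ?size_takel ?size_drop; lia.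
by rewrite IHa ?IHb ?IHc ?map_take ?map_drop ?size_takel ?size_drop //; lia.
Qed.

Section PlugSum.
Variables (K : fieldType) (A : bitri_algebra K) (X : eqType) (r : seq X).

(** Multilinear expansion: each leaf receives its own combination of the
    [y k], and the result is a sum over all words of choices. *)
Lemma plug_sum (y : X -> A) t (cs : seq (X -> K)) : size cs = ndegree t ->
  plug t [seq \sum_(k <- r) a k *: y k | a <- cs]
  = \sum_(w <- words r (ndegree t))
      (\prod_(p <- zip cs w) p.1 p.2) *: plug t (map y w).
Proof.
have szw n w : w \in words r n -> size w = n.
  by rewrite mem_words => /andP[/eqP].
elim: t cs => [k|a IHa b IHb|a IHa b IHb c IHc] cs szc.
- case: cs szc => [|e [|]] // _; rewrite [RHS]big_allpairs_dep /=.
  by apply: eq_bigr => x _; rewrite !big_seq1.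
- rewrite /= in szc *; rewrite -map_take -map_drop IHa ?IHb ?size_takel ?size_drop; try lia.
  rewrite brk_sum big_words_cat.
  apply: eq_big_seq => u /szw szu; apply: eq_big_seq => v /szw szv.
  rewrite map_cat take_size_cat ?size_map // drop_size_cat ?size_map //.
  rewrite -{3}(cat_take_drop (ndegree a) cs) zip_cat ?big_cat //.
  by rewrite size_takel //; lia.
rewrite /= in szc *; rewrite -map_take -map_drop -map_take -map_drop.
rewrite IHa ?IHb ?IHc ?size_takel ?size_drop; try lia.
rewrite trp_sum -addnA big_words_cat; apply: eq_big_seq => u /szw szu.
rewrite big_words_cat; apply: eq_big_seq => v /szw szv.
apply: eq_big_seq => w /szw szz.
rewrite !map_cat take_size_cat ?size_map // drop_size_cat ?size_map //.
rewrite take_size_cat ?size_map // drop_size_cat ?size_map //.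
rewrite -{4}(cat_take_drop (ndegree a) cs) zip_cat ?big_cat /=; last first.
  by rewrite size_takel //; lia.
rewrite -{3}(cat_take_drop (ndegree b) (drop _ cs)) zip_cat ?big_cat /= ?mulrA //.
by rewrite size_takel // size_drop; lia.
Qed.

End PlugSum.

(** The first argument is recursion fuel. *)
Fixpoint trees (k n : nat) : seq nmonom :=
  if k is k'.+1 then
    (if n == 1%N then [:: Var 0] else [::])
    ++ flatten [seq [seq Br a b | a <- trees k' i, b <- trees k' (n - i)]
               | i <- iota 1 n.-1]
    ++ flatten [seq flatten
         [seq [seq Tr p.1 p.2 c
              | p <- [seq (a, b) | a <- trees k' i, b <- trees k' j],
                c <- trees k' (n - i - j)]
         | j <- iota 1 (n - i).-1] | i <- iota 1 n.-1]
  else [::].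

Definition shapes (n : nat) : seq nmonom := undup (trees n n).

Lemma trees_shape k n t : t \in trees k n -> shape t = t /\ ndegree t = n.
Proof.
elim: k n t => //= k IHk n t; rewrite !mem_cat => /or3P[].
- by case: eqP => // ->; rewrite inE => /eqP ->.
- case/flatten_mapP => i; rewrite mem_iota => lti.
  case/allpairsP => -[a b] /= [/IHk[sa da] /IHk[sb db] ->].
  by rewrite /= sa sb da db; split=> //; lia.
case/flatten_mapP => i; rewrite mem_iota => lti.
case/flatten_mapP => j; rewrite mem_iota => ltj.
case/allpairsP => -[p c] /= [/allpairsP[[a b]] /= [/IHk[sa da] /IHk[sb db] ->]].
by move=> /IHk[sc dc] ->; rewrite /= sa sb sc da db dc; split=> //; lia.
Qed.

Lemma mem_trees k m : (ndegree m <= k)%N -> shape m \in trees k (ndegree m).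
Proof.
elim: k m => [|k IHk] m; first by have := ndegree_gt0 m; case: (ndegree m).
case: m => [i|a b|a b c] //= led.
- have [da db] := (ndegree_gt0 a, ndegree_gt0 b).
  rewrite !mem_cat; apply/or3P/Or32/flatten_mapP.
  exists (ndegree a); first by rewrite mem_iota; lia.
  apply/allpairsP; exists (shape a, shape b); split=> //=.
    by apply: IHk; lia.
  by rewrite addKn; apply: IHk; lia.
have [[da db] dc] := (ndegree_gt0 a, ndegree_gt0 b, ndegree_gt0 c).
rewrite !mem_cat; apply/or3P/Or33/flatten_mapP.
exists (ndegree a); first by rewrite mem_iota; lia.
apply/flatten_mapP; exists (ndegree b); first by rewrite mem_iota; lia.
apply/allpairsP; exists ((shape a, shape b), shape c); split=> //=.
  by apply/allpairsP; exists (shape a, shape b); split=> //=; apply: IHk; lia.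
by rewrite -addnA addKn addKn; apply: IHk; lia.
Qed.

Lemma shapesP n t : t \in shapes n -> shape t = t /\ ndegree t = n.
Proof. by rewrite mem_undup => /trees_shape. Qed.

Lemma mem_shapes m : shape m \in shapes (ndegree m).
Proof. by rewrite mem_undup mem_trees. Qed.

(** * Polarization *)

(** Inclusion-exclusion over the subsets [b] of [0, ..., n-1]: the signed sum of
    the indicators that [b] contains all letters of [v] vanishes unless every
    [k < n] occurs in [v], which for a word of length [n] means that [v] is a
    permutation. It factors over [k], with factor [1 - 1] at a missing [k]. *)
Lemma big_words_sign (K : comNzRingType) n (v : seq nat) :
  size v = n -> all (mem (iota 0 n)) v ->
  \sum_(b <- words [:: true; false] n)
     (\prod_(k < n) (-1) ^+ (~~ nth false b k)) *
     (\prod_(k <- v) (nth false b k)%:R)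
  = (perm_eq v (iota 0 n))%:R :> K.
Proof.
move=> szv vn.
pose g (k : nat) (x : bool) : K :=
  (-1) ^+ (~~ x) * (if k \in v then x%:R else 1).
have bool_prod (b : nat -> bool) (s : seq nat) : uniq s -> {subset v <= s} ->
    \prod_(k <- v) (b k)%:R
    = \prod_(k <- s) (if k \in v then (b k)%:R else 1) :> K.
  move=> us vs; have prodb (u : seq nat) : \prod_(k <- u) (b k)%:R = (all b u)%:R :> K.
    elim: u => [|k u IHu]; first by rewrite big_nil.
    by rewrite big_cons IHu /=; case: (b k); rewrite ?mul1r ?mul0r.
  rewrite prodb -big_mkcond -big_filter prodb; congr (nat_of_bool _)%:R.
  apply: eq_all_r => k; rewrite mem_filter.
  by case kv: (k \in v) => //=; rewrite vs.
transitivity (\sum_(b <- words [:: true; false] n)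
    \prod_(k < n) g k (nth false b k)).
  apply: eq_bigr => b _; rewrite /g big_split /=; congr (_ * _).
  rewrite (bool_prod _ (iota 0 n)) ?iota_uniq //; last exact/allP.
  by rewrite -[in RHS](big_mkord xpredT
    (fun k => if k \in v then (nth false b k)%:R else 1)) /index_iota subn0.
rewrite big_words_prod.
under eq_bigr do rewrite big_cons big_seq1 /g /= expr0 mul1r expr1.
have -> : perm_eq v (iota 0 n) = all (mem v) (iota 0 n).
  apply/idP/allP => [/perm_mem vE k|nv]; first by rewrite /= vE.
  have := leq_size_uniq (iota_uniq 0 n) nv; rewrite size_iota szv => /(_ (leqnn n)) uv.
  by apply: uniq_perm; rewrite ?iota_uniq // => k; apply/idP/idP;
    [exact: (allP vn)|exact: nv].
rewrite -(big_mkord xpredT (fun k => (if k \in v then true%:R else 1) +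
  -1 * (if k \in v then false%:R else 1) : K)) /index_iota subn0.
elim: (iota 0 n) => [|k s IHs]; first by rewrite big_nil.
rewrite big_cons IHs /=; case: (k \in v) => /=.
  by rewrite mulr0 addr0 mul1r.
by rewrite mulr1 subrr mul0r.
Qed.

Section Polarization.
Variables (K : fieldType) (A : bitri_algebra K) (c : nmonom -> K) (N n : nat).

(** The full polarization along [W]: in the signed sum, over the subsets [b] of
    [0, ..., n-1], of the values at [x_i := \sum_(k in b, W_k = i) y_k], only
    the terms that use each [y_k] once survive. A word [v] of indices then
    comes from the monomials whose leaves are [W o v]. *)
Lemma polarization :
  (forall s : nat -> A, \sum_(t <- shapes n) \sum_(w <- words (iota 0 N) n)
      c (fill t w) *: plug t (map s w) = 0) ->
  forall W (y : nat -> A), W \in words (iota 0 N) n ->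
  \sum_(t <- shapes n) \sum_(v <- permutations (iota 0 n))
    c (fill t (map (nth 0%N W) v)) *: plug t (map y v) = 0.
Proof.
move=> c0 W y Wn.
pose cs (b : seq bool) (i k : nat) : K :=
  (nth 0%N W k == i)%:R * (nth false b k)%:R.
pose s b i := \sum_(k <- iota 0 n) cs b i k *: y k.
pose sgn (b : seq bool) : K := \prod_(k < n) (-1) ^+ (~~ nth false b k).
have plugE t w b : t \in shapes n -> w \in words (iota 0 N) n ->
    plug t (map (s b) w) = \sum_(v <- words (iota 0 n) n)
      ((map (nth 0%N W) v == w)%:R * \prod_(k <- v) (nth false b k)%:R)
      *: plug t (map y v).
  case/shapesP => _ tn; rewrite mem_words => /andP[/eqP szw _].
  have -> : map (s b) w = [seq \sum_(k <- iota 0 n) a k *: y k | a <- map (cs b) w].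
    by rewrite -map_comp.
  rewrite plug_sum ?size_map ?szw tn //; refine (eq_big_seq _ _) => v.
  rewrite mem_words => /andP[/eqP szv _]; congr (_ *: _).
  have := szv; rewrite -szw; elim: (v) (w) => [|k v' IHv] [|i w'] //=.
    by rewrite !big_nil mulr1.
  move=> [szvw]; rewrite !big_cons IHv //= eqseq_cons -mulnb natrM /cs.
  by rewrite !mulrA; congr (_ * _); rewrite mulrAC.
have : \sum_(b <- words [:: true; false] n) sgn b *:
    (\sum_(t <- shapes n) \sum_(w <- words (iota 0 N) n)
      c (fill t w) *: plug t (map (s b) w)) = 0.
  by rewrite big1 // => b _; rewrite c0 scaler0.
under eq_bigr do rewrite scaler_sumr.
rewrite exchange_big /= => sum0; rewrite -[RHS]sum0 {sum0}.
refine (eq_big_seq _ _) => t tn.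
under [RHS]eq_bigr do rewrite scaler_sumr.
rewrite [RHS]exchange_big /=.
have wordE w : w \in words (iota 0 N) n ->
    \sum_(b <- words [:: true; false] n) sgn b *: (c (fill t w) *: plug t (map (s b) w))
    = \sum_(v <- words (iota 0 n) n | perm_eq v (iota 0 n))
      (map (nth 0%N W) v == w)%:R *: (c (fill t w) *: plug t (map y v)).
  move=> wn; under eq_bigr do rewrite plugE // !scaler_sumr.
  rewrite exchange_big [RHS]big_mkcond /=; refine (eq_big_seq _ _) => v.
  rewrite mem_words => /andP[/eqP szv vn].
  under eq_bigr do rewrite !scalerA.
  rewrite -scaler_suml.
  transitivity (((map (nth 0%N W) v == w)%:R * c (fill t w) *
      (perm_eq v (iota 0 n))%:R) *: plug t (map y v)).
    congr (_ *: _); rewrite -(big_words_sign K szv vn) mulr_sumr.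
    by apply: eq_bigr => b _; rewrite -/(sgn b); ring.
  by case: ifP; rewrite ?mulr1 ?scalerA // mulr0 scale0r.
rewrite (eq_big_seq _ wordE) exchange_big /=.
rewrite -[RHS]big_filter.
rewrite [RHS](perm_big (permutations (iota 0 n))) /=; last first.
  apply: uniq_perm; rewrite ?permutations_uniq ?filter_uniq ?words_uniq ?iota_uniq //.
  move=> v; rewrite mem_filter mem_permutations mem_words.
  case vn: (perm_eq v _) => //=; rewrite (perm_size vn) size_iota eqxx.
  by apply/allP => k; rewrite (perm_mem vn).
refine (eq_big_seq _ _) => v; rewrite mem_permutations => vn.
have vW : map (nth 0%N W) v \in words (iota 0 N) n.
  move: Wn; rewrite !mem_words size_map (perm_size vn) size_iota eqxx.
  move=> /andP[/eqP szW /allP WN]; apply/allP => _ /mapP[k kv ->].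
  by apply: WN; rewrite mem_nth // szW; rewrite (perm_mem vn) mem_iota in kv.
rewrite (bigD1_seq _ vW) ?words_uniq ?iota_uniq //= eqxx scale1r.
by rewrite big1 ?addr0 // => w; rewrite eq_sym => /negPf ->; rewrite scale0r.
Qed.

(** Setting [y_k := s (W_k)] and summing over all [W] counts every monomial
    once for each permutation [v], because [W |-> W o v] permutes the words. *)
Lemma restitution : n`!%:R != 0 :> K ->
  (forall W (y : nat -> A), W \in words (iota 0 N) n ->
    \sum_(t <- shapes n) \sum_(v <- permutations (iota 0 n))
      c (fill t (map (nth 0%N W) v)) *: plug t (map y v) = 0) ->
  forall s : nat -> A, \sum_(t <- shapes n) \sum_(w <- words (iota 0 N) n)
      c (fill t w) *: plug t (map s w) = 0.
Proof.
move=> nf c0 s; apply/eqP; rewrite -(inj_eq (scalerI nf)) scaler0; apply/eqP.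
have : \sum_(W <- words (iota 0 N) n) \sum_(t <- shapes n)
    \sum_(v <- permutations (iota 0 n)) c (fill t (map (nth 0%N W) v)) *:
      plug t (map (fun k => s (nth 0%N W k)) v) = 0.
  by rewrite big_seq big1 // => W WN; rewrite (c0 _ (fun k => s (nth 0%N W k))).
rewrite exchange_big /= => sum0; rewrite -[RHS]sum0 {sum0} scaler_sumr.
apply: eq_bigr => t _.
rewrite [RHS]exchange_big /=.
rewrite [RHS](eq_big_seq (fun=> \sum_(w <- words (iota 0 N) n)
  c (fill t w) *: plug t (map s w))); last first.
  move=> v; rewrite mem_permutations => vn.
  have uv : uniq v by rewrite (perm_uniq vn) iota_uniq.
  pose act W := map (nth 0%N W) v.
  transitivity (\sum_(w <- map act (words (iota 0 N) n))
    c (fill t w) *: plug t (map s w)).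
    by rewrite big_map; apply: eq_bigr => W _; rewrite -map_comp.
  apply: perm_big; apply: uniq_perm; rewrite ?words_uniq ?iota_uniq //.
    rewrite map_inj_in_uniq ?words_uniq ?iota_uniq // => W1 W2.
    rewrite !mem_words => /andP[/eqP sz1 _] /andP[/eqP sz2 _] /eq_in_map e.
    apply: (@eq_from_nth _ 0%N); rewrite ?sz1 ?sz2 // => k kn.
    by apply: e; rewrite (perm_mem vn) mem_iota.
  have szv : size v = n by rewrite (perm_size vn) size_iota.
  move=> w; apply/mapP/idP => [[W]|].
    rewrite !mem_words => /andP[/eqP szW /allP WN] ->.
    rewrite size_map szv eqxx; apply/allP => _ /mapP[k kv ->].
    by apply: WN; rewrite mem_nth // szW; rewrite (perm_mem vn) mem_iota in kv.
  rewrite mem_words => /andP[/eqP szw /allP wN].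
  exists (map (fun k => nth 0%N w (index k v)) (iota 0 n)).
    rewrite mem_words size_map size_iota eqxx; apply/allP => _ /mapP[k kn ->].
    by apply: wN; rewrite mem_nth // szw -szv index_mem (perm_mem vn).
  apply: (@eq_from_nth _ 0%N); rewrite ?size_map ?szv // => i.
  rewrite szw => ltin; have ltiv : (i < size v)%N by rewrite szv.
  have := mem_nth 0%N ltiv; rewrite (perm_mem vn) mem_iota /= => ltvn.
  by rewrite (nth_map 0%N) // (nth_map 0%N) ?size_iota // nth_iota // index_uniq.
rewrite big_const_seq count_predT size_permutations ?iota_uniq // size_iota.
by rewrite iter_addr_0 scaler_nat.
Qed.

End Polarization.

(** * Reduction to multilinear identities *)

Definition multilinear_monomials (n : nat) : seq nmonom :=
  [seq fill t v | t <- shapes n, v <- permutations (iota 0 n)].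

Lemma nmeval_scale (K : fieldType) (A : bitri_algebra K) x (s : nat -> A) m :
  nmeval (fun i => x *: s i) m = x ^+ ndegree m *: nmeval s m.
Proof.
elim: m => [k|a IHa b IHb|a IHa b IHb c IHc] /=; first by rewrite expr1.
  have := @brk_sum K A unit unit [:: tt] [:: tt] (fun=> x ^+ ndegree a)
    (fun=> x ^+ ndegree b) (fun=> nmeval s a) (fun=> nmeval s b).
  by rewrite !big_seq1 IHa IHb exprD => ->.
have := @trp_sum K A unit unit unit [:: tt] [:: tt] [:: tt] (fun=> x ^+ ndegree a)
  (fun=> x ^+ ndegree b) (fun=> x ^+ ndegree c)
  (fun=> nmeval s a) (fun=> nmeval s b) (fun=> nmeval s c).
by rewrite !big_seq1 IHa IHb IHc !exprD => ->.
Qed.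

Lemma poly_zero_everywhere (K : numFieldType) (p : {poly K}) :
  (forall x, p.[x] = 0) -> p = 0.
Proof.
move=> p0; apply/eqP; apply/negPn/negP => /(@max_poly_roots K p
  [seq i%:R | i <- iota 0 (size p)]) lt_size.
suff: (size p < size p)%N by rewrite ltnn.
rewrite -{1}(size_iota 0 (size p)) -(size_map (fun i => i%:R : K)).
apply: lt_size; first by apply/allP => x _; apply/rootP.
by rewrite map_inj_uniq ?iota_uniq // => i j /eqP; rewrite eqr_nat => /eqP.
Qed.

(** The homogeneous components are the coefficients of the polynomial
    [x |-> f (x *: s)], which vanishes on the infinite field [K]. *)
Lemma homogeneous_component (K : numFieldType) (f : nonassoc_poly K) :
  satisfies (V6 K) f -> forall (s : nat -> V6 K) n,
  \sum_(m <- msupp f | ndegree m == n) f@_m *: nmeval s m = 0.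
Proof.
move=> f0 s n.
suff: (\sum_(m <- msupp f | ndegree m == n) f@_m *: nmeval s m : 'rV[K]_7) = 0
  by [].
apply/rowP => j; rewrite summxE [RHS]mxE.
pose p : {poly K} :=
  \sum_(m <- msupp f) (f@_m * (nmeval s m : 'rV[K]_7) 0 j) *: 'X^(ndegree m).
have /polyP/(_ n) : p = 0.
  apply: poly_zero_everywhere => x; rewrite /p horner_sum.
  have := f0 (fun i => x *: s i); rewrite /neval => /rowP/(_ j).
  rewrite summxE [X in _ = X -> _]mxE => fx0; rewrite -[RHS]fx0.
  apply: eq_bigr => m _; rewrite nmeval_scale !mxE hornerZ hornerXn.
  by rewrite -mulrA; congr (_ * _); rewrite mulrC.
rewrite coef0 coef_sum => pn0; rewrite -[RHS]pn0 big_mkcond.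
apply: eq_bigr => m _; rewrite coefZ coefXn eq_sym.
by case: eqP => _; rewrite ?mulr1 ?mulr0 ?mxE.
Qed.

(** Shape and word of leaves are free coordinates on the monomials of degree
    [n], so a homogeneous component can be summed over all pairs of them. *)
Lemma component_by_shape (K : fieldType) (A : bitri_algebra K)
    (f : nonassoc_poly K) N n (s : nat -> A) :
  (forall m, m \in msupp f -> all (fun k => k < N)%N (leaves m)) ->
  \sum_(m <- msupp f | ndegree m == n) f@_m *: nmeval s m
  = \sum_(t <- shapes n) \sum_(w <- words (iota 0 N) n)
      f@_(fill t w) *: plug t (map s w).
Proof.
move=> fN.
transitivity (\sum_(m <- [seq fill t w | t <- shapes n, w <- words (iota 0 N) n])
    f@_m *: nmeval s m); last first.
  rewrite big_allpairs_dep; refine (eq_big_seq _ _) => t /shapesP[_ tn].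
  refine (eq_big_seq _ _) => w; rewrite mem_words => /andP[/eqP szw _].
  by rewrite nmeval_fill // szw tn.
rewrite [RHS](bigID (fun m => m \in msupp f)) /= [X in _ = _ + X]big1 ?addr0.
  rewrite -[LHS]big_filter -[RHS]big_filter; apply: perm_big.
  apply: uniq_perm; rewrite ?filter_uniq ?fset_uniq //.
    apply: allpairs_uniq; rewrite ?undup_uniq ?words_uniq ?iota_uniq //.
    move=> [t w] [t' w'] /allpairsP[[t1 w1] /= [/shapesP[st tn] wn [-> ->]]].
    case/allpairsP=> [[t2 w2] /= [/shapesP[st' tn'] wn' [-> ->]]] e.
    move: wn wn'; rewrite !mem_words => /andP[/eqP szw _] /andP[/eqP szw' _].
    rewrite -st -st' -(shape_fill t1 w1) -(shape_fill t2 w2) e.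
    by rewrite -(leaves_fill (t := t1) (w := w1)) ?e ?leaves_fill ?szw ?tn ?szw' ?tn'.
  move=> m; rewrite !mem_filter andbC; case mf: (m \in msupp f) => //=.
  apply/eqP/allpairsP => [mn|[[t w] /= [/shapesP[_ tn] _ ->]]]; last first.
    by rewrite ndegree_fill.
  exists (shape m, leaves m); rewrite fill_shape_leaves -mn; split=> //=.
    exact: mem_shapes.
  rewrite mem_words size_leaves eqxx; apply/allP => k /(allP (fN _ mf)) kN.
  by rewrite /= mem_iota.
by move=> m mf; rewrite mcoeff_outdom ?scale0r.
Qed.

(** Full polarization loses nothing in characteristic zero: a component of [f]
    is recovered, up to the factor [n!], from the multilinear polynomials
    obtained by polarizing it along all words [W]. Each of these is an identity
    of [V6 K], hence of [A] by hypothesis. *)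
Lemma multilinear_reduction (K : numFieldType) (A : bitri_algebra K) d
    (f : nonassoc_poly K) :
  (forall n (c : nmonom -> K), (n <= d)%N ->
     (forall y : nat -> V6 K,
        \sum_(p <- multilinear_monomials n) c p *: nmeval y p = 0) ->
     forall y : nat -> A,
        \sum_(p <- multilinear_monomials n) c p *: nmeval y p = 0) ->
  degree_le d f -> satisfies (V6 K) f -> satisfies A f.
Proof.
move=> transport fd f0 s.
(* A strict bound on the variables that occur in f. *)
pose N := (\max_(m <- msupp f) \max_(k <- leaves m) k).+1.
have fN m : m \in msupp f -> all (fun k => k < N)%N (leaves m).
  move=> mf; apply/allP => k km; rewrite /N ltnS.
  have kM : (k <= \max_(k <- leaves m) k)%N by exact: (@leq_bigmax_seq _ _ xpredT id k km isT).
  apply: (leq_trans kM).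
  exact: (@leq_bigmax_seq _ _ xpredT
    (fun m => \max_(k <- leaves m) k)%N m mf isT).
have multilinearE (B : bitri_algebra K) n W (y : nat -> B) :
    \sum_(p <- multilinear_monomials n)
       f@_(fill (shape p) (map (nth 0%N W) (leaves p))) *: nmeval y p
    = \sum_(t <- shapes n) \sum_(v <- permutations (iota 0 n))
       f@_(fill t (map (nth 0%N W) v)) *: plug t (map y v).
  rewrite big_allpairs_dep; refine (eq_big_seq _ _) => t /shapesP[st tn].
  refine (eq_big_seq _ _) => v; rewrite mem_permutations => /perm_size.
  rewrite size_iota => szv.
  by rewrite shape_fill st leaves_fill ?nmeval_fill ?szv ?tn.
have component0 n : (n <= d)%N ->
    \sum_(m <- msupp f | ndegree m == n) f@_m *: nmeval s m = 0.
  move=> nd; rewrite (component_by_shape _ _ fN).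
  apply: (restitution (c := fun m => f@_m)) => [|W y WN].
    by rewrite pnatr_eq0 -lt0n fact_gt0.
  rewrite -multilinearE; apply: transport => // z; rewrite multilinearE.
  apply: (polarization (c := fun m => f@_m) (N := N)) => // x.
  by rewrite -(component_by_shape _ _ fN) homogeneous_component.
rewrite /neval (eq_big_seq (fun m => \sum_(n < d.+1 | ndegree m == n)
    f@_m *: nmeval s m)).
  rewrite (exchange_big_dep xpredT) //= big1 // => n _.
  by apply: component0; rewrite -ltnS.
by move=> m /fd; rewrite -ltnS => md; rewrite (big_pred1 (Ordinal md)).
Qed.

(** * Canonical monomials of skew-symmetric operations *)

Fixpoint preorder_code (m : nmonom) : seq nat :=
  match m with
  | Var k => [:: k.+2]
  | Br a b => 0%N :: preorder_code a ++ preorder_code b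
  | Tr a b c => 1%N :: preorder_code a ++ preorder_code b ++ preorder_code c
  end.

Fixpoint lexle (u v : seq nat) : bool :=
  match u, v with
  | [::], _ => true
  | _, [::] => false
  | x :: u', y :: v' => (x < y)%N || ((x == y) && lexle u' v')
  end.

(** The first two arguments of every operation are put in increasing order of
    code. The flag records the parity of the number of swaps. *)
Fixpoint canon (m : nmonom) : bool * nmonom :=
  match m with
  | Var k => (false, m)
  | Br a b =>
      let: (e, a') := canon a in
      let: (f, b') := canon b in
      if lexle (preorder_code a') (preorder_code b')
      then (e (+) f, Br a' b') else (~~ (e (+) f), Br b' a')
  | Tr a b c =>
      let: (e, a') := canon a in
      let: (f, b') := canon b in
      let: (g, c') := canon c in
      if lexle (preorder_code a') (preorder_code b')
      then (e (+) f (+) g, Tr a' b' c') else (~~ (e (+) f (+) g), Tr b' a' c')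
  end.

Definition canonical_monomials (n : nat) : seq nmonom :=
  [seq m <- multilinear_monomials n | (canon m).2 == m].

Definition zpoly : Type := seq (Z * nmonom).

Definition coordinate_row (C : seq nmonom) (t : Z * nmonom) : seq Z :=
  let: (b, m) := canon t.2 in
  let z := if b then Z.opp t.1 else t.1 in
  map (fun q => if q == m then z else Z0) C.

Definition coordinates (C : seq nmonom) (P : zpoly) : seq Z :=
  foldr (fun t v => lincomb 1%coqZ (coordinate_row C t) 1%coqZ v) [::] P.

Section Canonical.
Variables (K : numFieldType) (A : bitri_algebra K).
Hypothesis brkC : forall x y : A, brk x y = - brk y x.
Hypothesis trpC : forall x y z : A, trp x y z = - trp y x z.
Implicit Types (s : nat -> A) (m : nmonom) (C : seq nmonom).

Definition zeval s (P : zpoly) : A := \sum_(t <- P) ofZ K t.1 *: nmeval s t.2.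

Lemma nmeval_canon s m :
  nmeval s m = (-1) ^+ (canon m).1 *: nmeval s (canon m).2.
Proof.
elim: m => [k|a IHa b IHb|a IHa b IHb c IHc] /=; first by rewrite scale1r.
  rewrite IHa IHb; case: (canon a) => e a'; case: (canon b) => f b' /=.
  have := @brk_sum K A unit unit [:: tt] [:: tt] (fun=> (-1) ^+ e)
    (fun=> (-1) ^+ f) (fun=> nmeval s a') (fun=> nmeval s b').
  rewrite !big_seq1 -signr_addb => ->; case: ifP => //= _.
  by rewrite signrN scaleNr -scalerN -brkC.
rewrite IHa IHb IHc; case: (canon a) => e a'; case: (canon b) => f b'.
case: (canon c) => g c' /=.
have := @trp_sum K A unit unit unit [:: tt] [:: tt] [:: tt]
  (fun=> (-1) ^+ e) (fun=> (-1) ^+ f) (fun=> (-1) ^+ g)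
  (fun=> nmeval s a') (fun=> nmeval s b') (fun=> nmeval s c').
rewrite !big_seq1 -!signr_addb => ->; case: ifP => //= _.
by rewrite signrN scaleNr -scalerN -trpC.
Qed.

Lemma big_select (G : nmodType) C (F : nmonom -> G) m : uniq C -> m \in C ->
  \sum_(i < size C) (if nth m C i == m then F (nth m C i) else 0) = F m.
Proof.
move=> uC mC; rewrite -(big_mkord xpredT (fun i =>
  if nth m C i == m then F (nth m C i) else 0)).
rewrite -(big_nth m xpredT (fun q => if q == m then F q else 0)).
rewrite (bigD1_seq m) //= eqxx big1 ?addr0 // => q /negPf -> //.
Qed.

Lemma zdot_coordinate_row C s t : uniq C -> (canon t.2).2 \in C ->
  zdot (coordinate_row C t) (map (nmeval s) C) = ofZ K t.1 *: nmeval s t.2.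
Proof.
move=> uC; rewrite /coordinate_row [in RHS]nmeval_canon.
case: (canon t.2) => b m /= mC; rewrite /zdot size_map.
rewrite -(big_select (fun q => ofZ K t.1 *: ((-1) ^+ b *: nmeval s q)) uC mC).
apply: eq_bigr => i _; rewrite !(nth_map m) //.
case: eqP => [->|_]; last by rewrite scale0r.
by case: b; rewrite ?ofZN ?expr1 ?scaleN1r ?scaleNr ?scalerN ?scale1r.
Qed.

Lemma zdot_coordinates C s (P : zpoly) : uniq C ->
  all (fun t => (canon t.2).2 \in C) P ->
  zdot (coordinates C P) (map (nmeval s) C) = zeval s P.
Proof.
move=> uC; rewrite /zeval; elim: P => [|t P IHP] /=.
  by move=> _; rewrite big_nil /zdot big1 // => i _; rewrite nth_nil scale0r.
case/andP => tC PC; rewrite zdot_lincomb !scale1r big_cons IHP //.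
by rewrite zdot_coordinate_row.
Qed.

(** The coefficient of the canonical monomial [q] in [\sum_(p <- L) c p *: p]. *)
Definition canonical_coef (L : seq nmonom) (c : nmonom -> K) q : K :=
  \sum_(p <- L) (if (canon p).2 == q then c p * (-1) ^+ (canon p).1 else 0).

(** With skew-symmetric operations, the value of a polynomial depends only on
    its canonical coefficients. *)
Lemma collect_canonical (L C : seq nmonom) (c : nmonom -> K) s : uniq C ->
  all (fun p => (canon p).2 \in C) L ->
  \sum_(p <- L) c p *: nmeval s p
  = \sum_(i < size C)
      (map (canonical_coef L c) C)`_i *: (map (nmeval s) C)`_i.
Proof.
move=> uC /allP LC.
under [RHS]eq_bigr do rewrite !(nth_map (Var 0)) // scaler_suml.
rewrite exchange_big /=; refine (eq_big_seq _ _) => p /LC pC.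
rewrite {1}nmeval_canon scalerA.
rewrite -(big_select (fun q => (c p * (-1) ^+ (canon p).1) *: nmeval s q) uC pC).
apply: eq_bigr => i _; rewrite eq_sym (set_nth_default (Var 0)) //.
by case: ifP => // _; rewrite scale0r.
Qed.

End Canonical.

(** * The operations of V(6) on weight vectors *)

Definition weights : seq Z :=
  [:: 6; 4; 2; 0; -2; -4; -6]%coqZ.

(** A triple [(p, q, z)] is the coefficient [z] of the value at [v_p /\ v_q]. *)
Definition alpha_coefs : seq (Z * Z * Z) :=
  [:: (6, 0, 20); (6, -2, 10); (6, -4, 4); (6, -6, 1); (4, 2, -60);
      (4, 0, -20); (4, -4, 6); (4, -6, 4); (2, 0, -20); (2, -2, -15);
      (2, -6, 10); (0, -2, -20); (0, -4, -20); (0, -6, 20);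
      (-2, -4, -60)]%coqZ.

Definition beta0_coefs : seq (Z * Z * Z) :=
  [:: (6, -4, 2); (6, -6, 1); (4, -2, -10); (4, -4, -4); (4, -6, 2);
      (2, 0, 20); (2, -2, 5); (2, -4, -10); (0, -2, 20)]%coqZ.

Definition wedge_coef (t : seq (Z * Z * Z)) (p q : Z) : Z :=
  foldr (fun e z => Z.add
    (Z.sub (if Z.eqb p e.1.1 && Z.eqb q e.1.2 then e.2 else Z0)
           (if Z.eqb p e.1.2 && Z.eqb q e.1.1 then e.2 else Z0)) z) Z0 t.

(** [u_w . v_p = act_coef w p *: v_(w + p)]. *)
Definition act_coef (w p : Z) : Z :=
  if p \in weights then
    if Z.eqb w 2 then Z.opp (Z.div (8 + p) 2)
    else if Z.eqb w 0 then p
    else if Z.eqb w (-2) then Z.div (8 - p) 2 else Z0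
  else Z0.

(** At weight vectors a monomial takes the value [z v_w], coded as [(z, w)]. *)
Fixpoint weight_eval (s : nat -> Z) (m : nmonom) : Z * Z :=
  match m with
  | Var k => (1%coqZ, s k)
  | Br a b =>
      let: (x, p) := weight_eval s a in
      let: (y, q) := weight_eval s b in
      (x * y * wedge_coef alpha_coefs p q, p + q)%coqZ
  | Tr a b c =>
      let: (x, p) := weight_eval s a in
      let: (y, q) := weight_eval s b in
      let: (z, r) := weight_eval s c in
      (x * y * z * (-30 * wedge_coef beta0_coefs p q * act_coef (p + q) r),
       p + q + r)%coqZ
  end.

Section WeightVectors.
Variable K : numFieldType.
Local Notation zvec p := (wvec K (int_of_Z p)).

Lemma wt_inj : injective wt.
Proof. by move=> i j; rewrite /wt => e; apply/val_inj => /=; lia. Qed.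

Lemma crd_wvec p i : crd (wvec K p) (wt i) = (p == wt i)%:R.
Proof.
rewrite /crd (big_pred1 i) ?mxE // => j /=.
by rewrite (inj_eq wt_inj) eq_sym.
Qed.

Lemma weightP r : r \in weights -> exists i, int_of_Z r = wt i.
Proof.
rewrite !inE; do !case/orP; move=> /eqP->.
- by exists (inord 0); rewrite /wt inordK.
- by exists (inord 1); rewrite /wt inordK.
- by exists (inord 2); rewrite /wt inordK.
- by exists (inord 3); rewrite /wt inordK.
- by exists (inord 4); rewrite /wt inordK.
- by exists (inord 5); rewrite /wt inordK.
- by exists (inord 6); rewrite /wt inordK.
Qed.

Lemma zvec_eq0 r : r \notin weights -> zvec r = 0.
Proof.
move=> nr; apply/rowP => i; rewrite !mxE; case: eqP => // e; case/negP: nr.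
suff: Z_of_int (wt i) \in weights by rewrite -e int_of_ZK.
by case: i {e} => [[|[|[|[|[|[|[|]]]]]]]].
Qed.

Lemma crd_zvec p a : a \in weights -> crd (zvec p) (int_of_Z a) = (Z.eqb p a)%:R.
Proof.
case/weightP => i e; rewrite e crd_wvec -e (inj_eq (can_inj int_of_ZK)).
by [].
Qed.

(** Each entry of the tables has its value in the weight space of the sum of
    the two weights, so the operation on weight vectors is a scalar. *)
Lemma wedge_map_zvec (W : lmodType K) (u : Z -> W) (t : seq (Z * Z * Z)) p q :
  all (fun e => (e.1.1 \in weights) && (e.1.2 \in weights)) t ->
  wedge_map [seq ((int_of_Z e.1.1, int_of_Z e.1.2),
                  ofZ K e.2 *: u (Z.add e.1.1 e.1.2)) | e <- t] (zvec p) (zvec q)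
  = ofZ K (wedge_coef t p q) *: u (Z.add p q).
Proof.
rewrite /wedge_map big_map; elim: t => [|[[a b] z] t IHt].
  by rewrite big_nil scale0r.
move=> /= /andP[/andP[aw bw] tw]; rewrite big_cons IHt // ofZD [RHS]scalerDl.
congr (_ + _); rewrite /wedge_crd /= !crd_zvec //.
rewrite /Z.sub ofZD ofZN !scalerBl !scalerA; congr (_ - _).
  case: (Z.eqb_spec p a) => [->|_] /=; last by rewrite !mul0r !scale0r.
  case: (Z.eqb_spec q b) => [->|_] /=; last by rewrite mulr0 mul0r !scale0r.
  by rewrite !mul1r.
case: (Z.eqb_spec p b) => [->|_] /=; last by rewrite !mul0r !scale0r.
case: (Z.eqb_spec q a) => [->|_] /=; last by rewrite mulr0 mul0r !scale0r.
by rewrite !mul1r Z.add_comm.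
Qed.

Lemma alpha_tableE : alpha_table K =
  [seq ((int_of_Z e.1.1, int_of_Z e.1.2),
        ofZ K e.2 *: zvec (Z.add e.1.1 e.1.2)) | e <- alpha_coefs].
Proof.
(* The table has v 0 without its coefficient 1 at (6, -6). *)
by rewrite /alpha_table -{1}[wvec K 0]scale1r.
Qed.

Definition uvec (w : Z) : 'M[K]_2 :=
  if Z.eqb w 2 then u2 K else if Z.eqb w 0 then u0 K
  else if Z.eqb w (-2) then um2 K else 0.

Lemma beta0_tableE : beta0_table K =
  [seq ((int_of_Z e.1.1, int_of_Z e.1.2),
        ofZ K e.2 *: uvec (Z.add e.1.1 e.1.2)) | e <- beta0_coefs].
Proof.
by rewrite /beta0_table -{1}[u0 K]scale1r.
Qed.

Lemma sum_wvec (u : 'I_7 -> 'rV[K]_7) i :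
  \sum_j wvec K (wt i) 0 j *: u j = u i.
Proof.
rewrite (bigD1 i) //= mxE eqxx scale1r big1 ?addr0 // => j ne.
by rewrite mxE (inj_eq wt_inj) eq_sym (negPf ne) scale0r.
Qed.

Lemma sl2_act_u2 x : sl2_act (u2 K) x = - actE x.
Proof.
by rewrite /sl2_act /u2 /slE !mxE /= ?oppr0 ?scale0r !addr0 scaleN1r.
Qed.

Lemma sl2_act_u0 x : sl2_act (u0 K) x = actH x.
Proof.
by rewrite /sl2_act /u0 /slH !mxE /= !subr0 ?scale0r add0r addr0 scale1r.
Qed.

Lemma sl2_act_um2 x : sl2_act (um2 K) x = actF x.
Proof.
by rewrite /sl2_act /um2 /slF !mxE /= ?scale0r !add0r scale1r.
Qed.

Lemma act_zvec r : r \in weights ->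
  [/\ actE (zvec r) = ofZ K (Z.div (8 + r) 2) *: zvec (Z.add 2 r),
      actH (zvec r) = ofZ K r *: zvec r
    & actF (zvec r) = ofZ K (Z.div (8 - r) 2) *: zvec (Z.add (-2) r)].
Proof.
move=> /weightP[i ri]; have -> : r = Z_of_int (wt i) by rewrite -ri int_of_ZK.
rewrite Z_of_intK /actE /actH /actF !sum_wvec.
by case: i {ri} => [[|[|[|[|[|[|[|]]]]]]]] // lti; split; congr (_ *: wvec K _).
Qed.

Lemma sl2_act_uvec w r :
  sl2_act (uvec w) (zvec r) = ofZ K (act_coef w r) *: zvec (Z.add w r).
Proof.
rewrite /act_coef; case: ifPn => [/act_zvec[rE rH rF]|/zvec_eq0 ->]; last first.
  by rewrite scale0r (linear_fun0 (sl2_act_linear (uvec w))).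
rewrite /uvec; case: Z.eqb_spec => [->|_].
  by rewrite sl2_act_u2 rE ofZN scaleNr.
case: Z.eqb_spec => [->|_]; first by rewrite sl2_act_u0 rH.
case: Z.eqb_spec => [->|_]; first by rewrite sl2_act_um2 rF.
by rewrite scale0r (linear_fun0 (sl2_act_linearl (zvec r))).
Qed.

Lemma V6_brk_zvec p q :
  @brk K (V6 K) (zvec p) (zvec q)
  = ofZ K (wedge_coef alpha_coefs p q) *: zvec (Z.add p q).
Proof.
transitivity (alpha (zvec p) (zvec q)) => //.
by rewrite /alpha alpha_tableE (wedge_map_zvec (fun w => zvec w)).
Qed.

Lemma V6_trp_zvec p q r :
  @trp K (V6 K) (zvec p) (zvec q) (zvec r)
  = ofZ K (-30 * wedge_coef beta0_coefs p q * act_coef (p + q) r)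
    *: zvec (p + q + r)%coqZ.
Proof.
transitivity (sl2_act (beta (zvec p) (zvec q)) (zvec r)) => //.
rewrite /beta /beta0 beta0_tableE wedge_map_zvec // scalerA.
have := @linear_fun_sum K _ _ (fun A => sl2_act A (zvec r)) unit [:: tt]
  (fun=> (-30 * ofZ K (wedge_coef beta0_coefs p q))) (fun=> uvec (Z.add p q))
  (@sl2_act_linearl K (zvec r)).
by rewrite !big_seq1 => ->; rewrite sl2_act_uvec scalerA !ofZM.
Qed.

Lemma nmeval_zvec (s : nat -> Z) m :
  nmeval (fun k => zvec (s k) : V6 K) m
  = ofZ K (weight_eval s m).1 *: zvec (weight_eval s m).2.
Proof.
elim: m => [k|a IHa b IHb|a IHa b IHb c IHc]; first by rewrite scale1r.
  rewrite [LHS]/= IHa IHb /=.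
  case: (weight_eval s a) => x p; case: (weight_eval s b) => y q.
  have := @brk_sum K (V6 K) unit unit [:: tt] [:: tt] (fun=> ofZ K x)
    (fun=> ofZ K y) (fun=> zvec p) (fun=> zvec q).
  by rewrite !big_seq1 => e; apply: (etrans e); rewrite V6_brk_zvec scalerA -!ofZM.
rewrite [LHS]/= IHa IHb IHc /=.
case: (weight_eval s a) => x p; case: (weight_eval s b) => y q.
case: (weight_eval s c) => z r.
have := @trp_sum K (V6 K) unit unit unit [:: tt] [:: tt] [:: tt] (fun=> ofZ K x)
  (fun=> ofZ K y) (fun=> ofZ K z) (fun=> zvec p) (fun=> zvec q) (fun=> zvec r).
by rewrite !big_seq1 => e; apply: (etrans e); rewrite V6_trp_zvec scalerA -!ofZM.
Qed.

Lemma V6_brkC (x y : V6 K) : brk x y = - brk y x.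
Proof.
rewrite /= /V6_brk /alpha /wedge_map -sumrN; apply: eq_bigr => e _.
by rewrite -scaleNr; congr (_ *: _); rewrite /wedge_crd; ring.
Qed.

Lemma V6_trpC (x y z : V6 K) : trp x y z = - trp y x z.
Proof.
suff e : beta x y = (-1) *: beta y x + 0.
  have := sl2_act_linearl z (-1) (beta y x) 0; rewrite -e.
  by rewrite (linear_fun0 (sl2_act_linearl z)) addr0 scaleN1r.
rewrite addr0 scaleN1r /beta -scalerN; congr (_ *: _).
rewrite /beta0 /wedge_map -sumrN; apply: eq_bigr => e _.
by rewrite -scaleNr; congr (_ *: _); rewrite /wedge_crd; ring.
Qed.

End WeightVectors.

(** * Consequences of the six identities *)

Definition jacobi_relation (a b c : nmonom) : zpoly :=
  [:: (1%coqZ, Br (Br a b) c); (1%coqZ, Br (Br b c) a);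
      (1%coqZ, Br (Br c a) b); (1%coqZ, Tr a b c); (1%coqZ, Tr b c a);
      (1%coqZ, Tr c a b)].

Definition malcev_relation (a b c d : nmonom) : zpoly :=
  [:: (1%coqZ, Br (Br (Br a c) b) d); (1%coqZ, Br (Br (Br d a) c) b);
      (1%coqZ, Br (Br (Br c b) d) a); (1%coqZ, Br (Br (Br b d) a) c);
      ((-1)%coqZ, Br (Br a b) (Br c d))].

Definition cyclic_relation (a b c d : nmonom) : zpoly :=
  [:: (1%coqZ, Tr (Br a b) c d); (1%coqZ, Tr (Br b c) a d);
      (1%coqZ, Tr (Br c a) b d)].

Definition derivation_relation (a b c d : nmonom) : zpoly :=
  [:: (1%coqZ, Br (Tr a b c) d); ((-1)%coqZ, Br (Tr a b d) c);
      ((-1)%coqZ, Tr a b (Br c d))].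

(** In degree four, besides the instances of the identities of degree four:
    the mixed Jacobi identity with one variable replaced by a bracket, and its
    bracket with a fourth variable. *)
Definition relations (n : nat) : seq zpoly :=
  flatten [seq
    match map Var v with
    | [:: a; b; c] => [:: jacobi_relation a b c]
    | [:: a; b; c; d] =>
        [:: derivation_relation a b c d; cyclic_relation a b c d;
            jacobi_relation (Br a b) c d;
            [seq (t.1, Br t.2 d) | t <- jacobi_relation a b c];
            malcev_relation a b c d]
    | _ => [::]
    end | v <- permutations (iota 0 n)].

Section Evaluation.
Variables (K : fieldType) (A : bitri_algebra K).
Implicit Types (s : nat -> A) (f g : nonassoc_poly K).

Lemma neval_domain s f (D : {fset nmonom}) : (msupp f `<=` D)%fset ->
  neval s f = \sum_(m <- D) f@_m *: nmeval s m.
Proof.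
move=> fD; rewrite /neval (big_fset_incl _ fD) // => m _ mf.
by rewrite mcoeff_outdom ?scale0r.
Qed.

Lemma nevalD s f g : neval s (f + g) = neval s f + neval s g.
Proof.
rewrite (neval_domain s (msuppD_le f g)).
rewrite (neval_domain s (fsubsetUl (msupp f) (msupp g))).
rewrite (neval_domain s (fsubsetUr (msupp f) (msupp g))) -big_split /=.
by apply: eq_bigr => m _; rewrite mcoeffD scalerDl.
Qed.

Lemma nevalN s f : neval s (- f) = - neval s f.
Proof.
rewrite /neval msuppN -sumrN.
by apply: eq_bigr => m _; rewrite mcoeffN scaleNr.
Qed.

Lemma nevalU s m : neval s (<< m >> : nonassoc_poly K) = nmeval s m.
Proof.
by rewrite (neval_domain s msuppU_le) big_seq_fset1 mcoeffUU scale1r.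
Qed.

End Evaluation.

Lemma in_seq6 (T : eqType) (P : T -> Prop) a b c d e f :
  {in [:: a; b; c; d; e; f], forall x, P x} ->
  [/\ P a, P b, P c, P d & P e /\ P f].
Proof. by move=> H; split; last split; apply: H; rewrite !inE eqxx ?orbT. Qed.

Section Variety.
Variables (K : numFieldType) (A : bitri_algebra K).
Hypothesis identitiesA : {in [:: anticommutativity K; skew_symmetry K;
  mixed_jacobi K; malcev K; cyclic_identity K; derivation_identity K],
  forall g, satisfies A g}.

Lemma variety_brkC (x y : A) : brk x y = - brk y x.
Proof.
have [+ _ _ _ _] := in_seq6 identitiesA.
move=> /(_ (nth 0 [:: x; y])); rewrite /anticommutativity nevalD 2!nevalU /=.
by move/eqP; rewrite addr_eq0 => /eqP.
Qed.

Lemma variety_trpC (x y z : A) : trp x y z = - trp y x z.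
Proof.
have [_ + _ _ _] := in_seq6 identitiesA.
move=> /(_ (nth 0 [:: x; y; z])); rewrite /skew_symmetry nevalD 2!nevalU /=.
by move/eqP; rewrite addr_eq0 => /eqP.
Qed.

Lemma zeval_jacobi (s : nat -> A) a b c : zeval s (jacobi_relation a b c) = 0.
Proof.
have [_ _ + _ _] := in_seq6 identitiesA.
move=> /(_ (nth 0 (map (nmeval s) [:: a; b; c])));
  rewrite /mixed_jacobi 5!nevalD 6!nevalU /= => e0.
by rewrite -[RHS]e0 /zeval !big_cons big_nil /= !scale1r addr0 !addrA.
Qed.

Lemma zeval_malcev (s : nat -> A) a b c d :
  zeval s (malcev_relation a b c d) = 0.
Proof.
have [_ _ _ + _] := in_seq6 identitiesA.
move=> /(_ (nth 0 (map (nmeval s) [:: a; b; c; d])));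
  rewrite /malcev 4!nevalD nevalN 5!nevalU /= => e0.
by rewrite -[RHS]e0 /zeval !big_cons big_nil /= !scale1r scaleN1r addr0 !addrA.
Qed.

Lemma zeval_cyclic (s : nat -> A) a b c d :
  zeval s (cyclic_relation a b c d) = 0.
Proof.
have [_ _ _ _ [+ _]] := in_seq6 identitiesA.
move=> /(_ (nth 0 (map (nmeval s) [:: a; b; c; d])));
  rewrite /cyclic_identity 2!nevalD 3!nevalU /= => e0.
by rewrite -[RHS]e0 /zeval !big_cons big_nil /= !scale1r addr0 !addrA.
Qed.

Lemma zeval_derivation (s : nat -> A) a b c d :
  zeval s (derivation_relation a b c d) = 0.
Proof.
have [_ _ _ _ [_ +]] := in_seq6 identitiesA.
move=> /(_ (nth 0 (map (nmeval s) [:: a; b; c; d])));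
  rewrite /derivation_identity 2!nevalD 2!nevalN 3!nevalU /= => e0.
by rewrite -[RHS]e0 /zeval !big_cons big_nil /= !scale1r !scaleN1r addr0 !addrA.
Qed.

Lemma zeval_br (s : nat -> A) (P : zpoly) m : zeval s P = 0 ->
  zeval s [seq (t.1, Br t.2 m) | t <- P] = 0.
Proof.
move=> P0; have [brl _] := brk_bilinear A.
transitivity (brk (zeval s P) (nmeval s m)).
  by rewrite /zeval big_map (linear_fun_sum _ _ _ (brl _)).
by rewrite P0 (linear_fun0 (brl _)).
Qed.

Lemma zeval_relations (s : nat -> A) n P : P \in relations n -> zeval s P = 0.
Proof.
case/flatten_mapP => v _.
case: (map Var v) => [|a [|b [|c [|d [|]]]]] //; rewrite !inE.
  by move/eqP->; exact: zeval_jacobi.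
case/or4P => [/eqP->|/eqP->|/eqP->|/orP[]/eqP->].
- exact: zeval_derivation.
- exact: zeval_cyclic.
- exact: zeval_jacobi.
- exact/zeval_br/zeval_jacobi.
exact: zeval_malcev.
Qed.

End Variety.

(** * The multilinear identities of degree at most four *)

(** The [v_6]-coordinates of the canonical monomials at weight vectors of total
    weight six. They determine a multilinear polynomial as an operation on
    V(6): the operation is an sl(2)-morphism from a tensor power of V(6) to the
    irreducible module V(6), so if it is nonzero its image contains [v_6], and
    [v_6] is then attained on the weight space of weight six. *)
Definition highest_weight_rows (n : nat) (C : seq nmonom) : seq (seq Z) :=
  [seq [seq (let: (z, w) := weight_eval (nth Z0 u) q in
             if Z.eqb w 6 then z else Z0) | q <- C]
  | u <- [seq u <- words weights n | Z.eqb (foldr Z.add Z0 u) 6]].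

Definition identities_suffice (n : nat) : bool :=
  let C := canonical_monomials n in
  let R := relations n in
  [&& uniq C,
      all (fun p => (canon p).2 \in C) (multilinear_monomials n),
      all (all (fun t => (canon t.2).2 \in C)) R
    & complementary (size C) (map (coordinates C) R) (highest_weight_rows n C)].

(** In degrees one to four there are 1, 1, 6 and 45 canonical monomials, the
    relations among them have rank 0, 0, 1 and 24, and the value rows have the
    complementary rank 1, 1, 5 and 21. *)
Lemma identities_suffice_le4 : all identities_suffice (iota 0 5).
Proof. by vm_compute. Qed.

Lemma zdot_highest_weight_row (K : numFieldType) n (c : nmonom -> K) C r :
  uniq C -> all (fun p => (canon p).2 \in C) (multilinear_monomials n) ->
  (forall y : nat -> V6 K,
     \sum_(p <- multilinear_monomials n) c p *: nmeval y p = 0) ->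
  r \in highest_weight_rows n C ->
  zdot r (map (canonical_coef (multilinear_monomials n) c) C : seq K^o) = 0.
Proof.
move=> uC monC c0 /mapP[u _ ->].
have := c0 (fun k => wvec K (int_of_Z (nth Z0 u k))).
rewrite (collect_canonical (@V6_brkC K) (@V6_trpC K) _ _ uC monC).
move/(congr1 (fun x : 'rV[K]_7 => x 0 0)); rewrite summxE [RHS]mxE => e0.
rewrite -[RHS]e0 /zdot size_map; apply: eq_bigr => i _.
rewrite !(nth_map (Var 0)) // nmeval_zvec !mxE.
case: (weight_eval _ _) => z w /=; rewrite mulrC; congr (_ * _).
have -> : wt 0 = int_of_Z 6 by [].
rewrite (inj_eq (can_inj int_of_ZK)) -[_ == _]/(Z.eqb w 6).
by case: Z.eqb; rewrite ?mulr1 ?mulr0.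
Qed.

(** The canonical coefficients of an identity of V(6) are killed by the value
    rows, the values of the canonical monomials in [A] are killed by the
    relations, and the two conditions are complementary. *)
Lemma multilinear_transport (K : numFieldType) (A : bitri_algebra K) n
    (c : nmonom -> K) : (n <= 4)%N ->
  {in [:: anticommutativity K; skew_symmetry K; mixed_jacobi K; malcev K;
          cyclic_identity K; derivation_identity K],
     forall g, satisfies A g} ->
  (forall y : nat -> V6 K,
     \sum_(p <- multilinear_monomials n) c p *: nmeval y p = 0) ->
  forall y : nat -> A,
     \sum_(p <- multilinear_monomials n) c p *: nmeval y p = 0.
Proof.
move=> n4 idA c0 y; have := allP identities_suffice_le4 n.
rewrite mem_iota ltnS n4 => /(_ isT); rewrite /identities_suffice.
set C := canonical_monomials n => /and4P[uC monC relC compl].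
rewrite (collect_canonical (variety_brkC idA) (variety_trpC idA) _ _ uC monC).
set cf := canonical_coef _ c.
have := @complementary_pairing_eq0 K A (map (coordinates C) (relations n))
  (highest_weight_rows n C) (map cf C) (map (nmeval y) C).
rewrite !size_map => /(_ compl erefl); apply.
  move=> r /mapP[P PR ->].
  rewrite (zdot_coordinates (variety_brkC idA) (variety_trpC idA)) //.
    exact: (zeval_relations idA y PR).
  exact: (allP relC).
by move=> r; apply: zdot_highest_weight_row.
Qed.

Theorem proposition6p2 (R : realType) (f : nonassoc_poly (R[i])) :
  degree_le 4 f ->
  satisfies (V6 (R[i])) f ->
  consequence
    [:: anticommutativity (R[i]); skew_symmetry (R[i]); mixed_jacobi (R[i]);
        malcev (R[i]); cyclic_identity (R[i]); derivation_identity (R[i])] f.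
Proof.

move=> f4 f0 A idA.
apply: (multilinear_reduction (K := R[i]) (d := 4)) => // n c n4.
exact: multilinear_transport.
Qed.
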